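(* Let $m,m_0$ be nonnegative integers and let $G$ be a $(2m+2m_0)$-edge-connected graph. For each vertex $v$, let $L(v)\subseteq \{m,\ldots, d_G(v)-m_0\}$. If for each vertex $v$, $$|L(v)|\ge \left\lceil\frac{d_G(v)}{2}\right\rceil+1,$$ then $G$ has an $m$-tree-connected factor $H$ with $d_H(v)\in L(v)$ for each vertex $v$ such that $G\setminus E(H)$ is $m_0$-tree-connected.
   Context: Graphs may have loops and multiple edges. A factor is a spanning subgraph. A graph is $m$-tree-connected if it contains $m$ edge-disjoint spanning trees. *)

(* Defs.v *)
From HB Require Import structures.
From mathcomp Require Import all_boot.

Set Implicit Arguments.
Unset Strict Implicit.
Unset Printing Implicit Defensive.

(* Finite graphs with loops and multiple edges allowed. The order of the two
   components of [ends e] carries no meaning: everything below is symmetric in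
   them. *)
Record mgraph := MGraph {
  vertex : finType;
  edge : finType;
  ends : edge -> vertex * vertex }.

(* A loop contributes 2. *)
Definition degree (G : mgraph) (v : vertex G) : nat :=
  \sum_(e : edge G) (((ends e).1 == v) + ((ends e).2 == v)).

Definition joins (G : mgraph) (e : edge G) (x y : vertex G) : bool :=
  (ends e == (x, y)) || (ends e == (y, x)).

Definition adjacent (G : mgraph) : rel (vertex G) :=
  fun x y => [exists e : edge G, joins e x y].

Definition connected (G : mgraph) : Prop :=
  forall x y : vertex G, connect (@adjacent G) x y.

(* The factor (spanning subgraph) of G with edge set F. In particular
   [factor (~: F)] is G with the edges of F deleted. *)
Definition factor (G : mgraph) (F : {set edge G}) : mgraph :=
  @MGraph (vertex G) {e : edge G | e \in F} (fun e => ends (val e)).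

Definition edge_connected (k : nat) (G : mgraph) : Prop :=
  forall F : {set edge G}, #|F| < k -> connected (factor (~: F)).

(* The list (v_1, e_1), ..., (v_k, e_k) encodes the closed walk
   v_1 e_1 v_2 ... v_k e_k v_1. A loop is a cycle of length 1, and two parallel
   edges form a cycle of length 2. *)
Definition is_cycle (G : mgraph) (c : seq (vertex G * edge G)) : Prop :=
  [/\ c <> [::], uniq (unzip1 c), uniq (unzip2 c)
    & cycle (fun p q => joins p.2 p.1 q.1) c].

Definition is_tree (G : mgraph) : Prop :=
  connected G /\ forall c : seq (vertex G * edge G), ~ is_cycle c.

(* The trees form an indexed family, so that a graph with a single vertex, whose
   only spanning tree has no edge, is m-tree-connected for every m. *)
Definition tree_connected (m : nat) (G : mgraph) : Prop :=
  exists T : 'I_m -> {set edge G},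
    (forall i j : 'I_m, i != j -> [disjoint T i & T j])
    /\ (forall i : 'I_m, is_tree (factor (T i))).

(* Main.v *)
(** Write k = m + m0. The key point is that G contains k edge-disjoint connected
    spanning edge sets together with, for every vertex v, a set of
    d(v)/2 - k (rounded down) reserved edges at v, all pairwise disjoint. This is
    a matroid-union statement for k graphic matroids and one truncated star
    matroid per vertex, and its rank condition is checked by counting: each
    component of (V, X) that does not contain a fixed root either has a vertex
    whose star is deficient in X, which saves k, or sends at least 2k edges out
    of X.

    Now put m of the connected sets in H and m0 of them in the complement. The
    degree at v then ranges over {m, ..., d(v) - m0}, in which at most
    d(v)/2 - k values lie outside L(v). Starting from the m connected sets, the
    greedy argument of Frank, Lau and Szabo adds reserved edges at vertices of
    bad degree until no bad degree is left. *)

Require Import Defs.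
From HB Require Import structures.
From mathcomp Require Import all_boot all_order all_algebra finmap.
From mathcomp Require Import zify.

Set Implicit Arguments.
Unset Strict Implicit.
Unset Printing Implicit Defensive.

Import GRing.Theory.

Local Open Scope nat_scope.

(** * Disjoint packing for monotone submodular functions *)

Section SubmodularPacking.

Variables (E J : finType) (r : J -> {set E} -> nat).
Hypothesis r_mono : forall j (X Y : {set E}), X \subset Y -> r j X <= r j Y.
Hypothesis r_submod : forall j (X Y : {set E}),
  r j (X :|: Y) + r j (X :&: Y) <= r j X + r j Y.

Implicit Types (W : {set E * J}) (X Y : {set E}).

Definition fiber W X j : {set E} := [set e in X | (e, j) \in W].

(** A pair [(e, j)] in [W] permits index [j] to use [e]. This is the right side of the rank
    condition when each [j] sees only its permitted elements; [W] is thinned, as in Rado's theorem,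
    until no element has two users. *)
Definition potential W X := \sum_j r j (fiber W X j) + #|~: X|.

Lemma potential_remove W X e j :
  e \notin X -> potential (W :\ (e, j)) X = potential W X.
Proof.
move=> eX; rewrite /potential; congr (_ + _); apply: eq_bigr => i _.
congr (r i _); apply/setP => x; rewrite !inE.
by case: (boolP (x \in X)) => //= xX; case: eqP => // -[xe _]; rewrite -xe xX in eX.
Qed.

Lemma potential_geVlt C W :
  (forall X, C <= potential W X) \/ (exists X, potential W X < C).
Proof.
case: (boolP [forall X : {set E}, C <= potential W X]) => [/forallP|/forallPn[X]].
  by left.
by rewrite -ltnNge; right; exists X.
Qed.

(* Sets X and Y violating the two conclusions both contain e; uncrossing them
   into X :|: Y and (X :&: Y) :\ e contradicts the hypothesis by one. *)
Lemma potential_shrink C W e (j1 j2 : J) : j1 != j2 ->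
    (forall X, C <= potential W X) ->
  (forall X, C <= potential (W :\ (e, j1)) X) \/
  (forall X, C <= potential (W :\ (e, j2)) X).
Proof.
move=> neq_j hC.
case: (potential_geVlt C (W :\ (e, j1))) => [|[X hX]]; first by left.
case: (potential_geVlt C (W :\ (e, j2))) => [|[Y hY]]; first by right.
exfalso.
have eX : e \in X.
  apply/negPn/negP => eX; move: hX; rewrite potential_remove // => h.
  by have := hC X; rewrite leqNgt h.
have eY : e \in Y.
  apply/negPn/negP => eY; move: hY; rewrite potential_remove // => h.
  by have := hC Y; rewrite leqNgt h.
(* Since [j1 != j2], a pair [(e, j)] of [W] survives in at least one of the two thinned relations,
   so the two smaller fibers still cover the fiber of the union. *)
have hj j : r j (fiber W (X :|: Y) j) + r j (fiber W ((X :&: Y) :\ e) j)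
   <= r j (fiber (W :\ (e, j1)) X j) + r j (fiber (W :\ (e, j2)) Y j).
  apply: leq_trans (r_submod _ _ _); apply: leq_add; apply: r_mono.
    apply/subsetP => x; rewrite !inE !xpair_eqE.
    case: (eqVneq x e) => [->|_] /=; last by rewrite -andb_orl.
    rewrite eX eY /= => ->; rewrite !andbT.
    by case: eqP => // ->; rewrite neq_j.
  apply/subsetP => x; rewrite !inE !xpair_eqE.
  by case: (eqVneq x e) => //= _ /andP[/andP[-> ->] ->].
have hs := @leq_sum _ (index_enum J) xpredT _ _ (fun j _ => hj j).
rewrite !big_split /= in hs.
have hc : #|~: (X :|: Y)| + #|~: ((X :&: Y) :\ e)| = #|~: X| + #|~: Y| + 1.
  have := cardsUI X Y; have := cardsD1 e (X :&: Y).
  have := cardsC X; have := cardsC Y; have := cardsC (X :|: Y).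
  have := cardsC ((X :&: Y) :\ e).
  by rewrite !inE eX eY /=; lia.
have := hC (X :|: Y); have := hC ((X :&: Y) :\ e).
move: hX hY hs hc; rewrite /potential; lia.
Qed.

Lemma potential_functional C W : (forall X, C <= potential W X) ->
  exists2 W', forall X, C <= potential W' X
    & forall e i j, (e, i) \in W' -> (e, j) \in W' -> i = j.
Proof.
have [n] := ubnP #|W|; elim: n W => // n IHn W leWn hC.
case: (boolP [exists e, exists i, exists j,
   [&& i != j, (e, i) \in W & (e, j) \in W]]); last first.
  move=> hW; exists W => // e i j ei ej; apply/eqP; apply: contraNT hW => neq_ij.
  apply/existsP; exists e; apply/existsP; exists i; apply/existsP; exists j.
  by rewrite neq_ij ei ej.
case/existsP => e /existsP[i /existsP[j /and3P[neq_ij ei ej]]].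
case: (potential_shrink e neq_ij hC); apply: IHn.
  by rewrite (cardsD1 (e, i) W) ei in leWn.
by rewrite (cardsD1 (e, j) W) ej in leWn.
Qed.

(** The full relation satisfies the bound by hypothesis. After thinning, the fibers are disjoint,
    and evaluating the bound at [setT] removes the complement term. *)
Theorem submodular_packing C :
    (forall X, C <= \sum_j r j X + #|~: X|) ->
  exists I : J -> {set E},
    (forall i j, i != j -> [disjoint I i & I j]) /\ C <= \sum_j r j (I j).
Proof.
move=> hC; case: (@potential_functional C setT) => [X|W hW funW].
  rewrite /potential; under eq_bigr => j _.
    rewrite (_ : fiber _ _ _ = X); last by apply/setP => x; rewrite !inE andbT.
    over.
  exact: hC.
exists (fiber W setT); split.
  move=> i j neq_ij; rewrite disjoints_subset; apply/subsetP => e; rewrite !inE /= => ei.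
  by apply: contraNN neq_ij => ej; apply/eqP; apply: funW ei ej.
by have := hW setT; rewrite /potential setCT cards0 addn0.
Qed.

End SubmodularPacking.

(** * Connectivity and the rank of edge vectors *)

Section Multigraph.

Variable G : mgraph.
Notation V := (vertex G).
Notation E := (edge G).
Implicit Types (X Y : {set E}) (e : E) (v x y : V).

Definition incidence e v : nat := ((ends e).1 == v) + ((ends e).2 == v).

Definition deg_in X v := \sum_(e in X) incidence e v.

Definition star v : {set E} := [set e | 0 < incidence e v].

Definition link X : rel V := fun x y => [exists e in X, joins e x y].

Definition spanning X := forall x y, connect (link X) x y.

Lemma joinsC e x y : joins e x y = joins e y x.
Proof. by rewrite /joins orbC. Qed.

Lemma link_sym X : symmetric (link X).
Proof. by move=> x y; apply: eq_existsb => e; rewrite joinsC. Qed.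

Lemma link_connect_sym X : connect_sym (link X).
Proof. exact/sym_connect_sym/link_sym. Qed.

Lemma connected_factor X : connected (factor X) <-> spanning X.
Proof.
have eq_adj : @adjacent (factor X) =2 link X.
  move=> x y; apply/existsP/exists_inP => [[e] je|[e eX je]].
    by exists (val e) => //; apply: valP.
  by exists (Sub e eX).
by split=> h x y; have := h x y; rewrite (eq_connect eq_adj).
Qed.

Local Open Scope ring_scope.

(* The dimension of a span is submodular for free. Adjoining the vector of a root
   x0 makes X connected exactly when the span is the whole space, so no separate
   bound by #|V| - 1 is needed. *)
Definition vertex_vec v : 'rV[rat]_#|V| := delta_mx 0 (enum_rank v).

Definition edge_vec e := vertex_vec (ends e).1 - vertex_vec (ends e).2.

Definition rooted_space x0 X :=
  (<<vertex_vec x0>> + \sum_(e in X) <<edge_vec e>>)%MS.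

Definition rooted_rank x0 X : nat := \rank (rooted_space x0 X).

Lemma root_in_space x0 X : (vertex_vec x0 <= rooted_space x0 X)%MS.
Proof. by apply: submx_trans (addsmxSl _ _); rewrite genmxE. Qed.

Lemma edge_in_space x0 X e : e \in X -> (edge_vec e <= rooted_space x0 X)%MS.
Proof.
move=> eX; apply: submx_trans (addsmxSr _ _).
by apply: submx_trans (sumsmx_sup e _ (submx_refl _)); rewrite ?genmxE.
Qed.

Lemma rooted_space_subP n x0 X (M : 'M_(n, _)) :
    (vertex_vec x0 <= M)%MS -> (forall e, e \in X -> (edge_vec e <= M)%MS) ->
  (rooted_space x0 X <= M)%MS.
Proof.
move=> h0 hX; rewrite addsmx_sub genmxE h0 /=.
by apply/sumsmx_subP => e eX; rewrite genmxE hX.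
Qed.

Lemma rooted_spaceS x0 X Y :
  X \subset Y -> (rooted_space x0 X <= rooted_space x0 Y)%MS.
Proof.
move=> /subsetP sXY; apply: rooted_space_subP; first exact: root_in_space.
by move=> e /sXY; apply: edge_in_space.
Qed.

Lemma rooted_rankS x0 X Y :
  X \subset Y -> (rooted_rank x0 X <= rooted_rank x0 Y)%N.
Proof. by move=> sXY; apply/mxrankS/rooted_spaceS. Qed.

Lemma rooted_rank_submod x0 X Y :
  (rooted_rank x0 (X :|: Y) + rooted_rank x0 (X :&: Y)
    <= rooted_rank x0 X + rooted_rank x0 Y)%N.
Proof.
rewrite -[X in (_ <= X)%N]mxrank_sum_cap; apply: leq_add; apply: mxrankS.
  apply: rooted_space_subP.
    by apply: submx_trans (addsmxSl _ _); apply: root_in_space.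
  move=> e; rewrite inE => /orP[eX|eY].
    by apply: submx_trans (addsmxSl _ _); apply: edge_in_space.
  by apply: submx_trans (addsmxSr _ _); apply: edge_in_space.
by rewrite sub_capmx !rooted_spaceS ?subsetIl ?subsetIr.
Qed.

Lemma connect_in_space x0 X x y : connect (link X) x y ->
  (vertex_vec x - vertex_vec y <= rooted_space x0 X)%MS.
Proof.
case/connectP => p; elim: p x => [|z p IHp] x /= => [_ ->|]; first by rewrite subrr sub0mx.
case/andP => /exists_inP[e eX je] pz yz.
rewrite -(subrKA (vertex_vec z)) addmx_sub ?IHp //.
have := edge_in_space x0 eX; rewrite /edge_vec.
by case/orP: je => /eqP -> //=; rewrite -opprB eqmx_opp.
Qed.

(** Modulo the edge vectors of [X], all vertices of a component have the same vector. The component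
    of [x0] already contains the root vector, so one representative from each other component
    completes the space. *)
Lemma rooted_rank_components x0 X :
  (#|V| <= rooted_rank x0 X
     + #|[set v | roots (link X) v && (v != fingraph.root (link X) x0)]|)%N.
Proof.
set R := [set v | _].
have sR : (\rank (\sum_(v in R) <<vertex_vec v>>)%MS <= #|R|)%N.
  apply: leq_trans (mxrank_sum_leqif _) _ => /=.
  by rewrite -[leqRHS]sum1_card; apply: leq_sum => v _; rewrite genmxE rank_leq_row.
apply: leq_trans (leq_add (leqnn _) sR).
apply: leq_trans (mxrank_adds_leqif _ _).
rewrite -[X in (X <= _)%N](mxrank1 rat); apply: mxrankS.
apply/row_subP => i; rewrite row1 -[i]enum_valK -/(vertex_vec _).
set v := enum_val i; rewrite -(subrK (vertex_vec (fingraph.root (link X) v)) (vertex_vec v)).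
apply: addmx_sub.
  apply: submx_trans (addsmxSl _ _).
  by apply: connect_in_space; apply: connect_root.
case: (eqVneq (fingraph.root (link X) v) (fingraph.root (link X) x0)) => [->|neq].
  apply: submx_trans (addsmxSl _ _).
  rewrite -(subrK (vertex_vec x0) (vertex_vec (fingraph.root _ _))) addmx_sub ?root_in_space //.
  by apply: connect_in_space; rewrite link_connect_sym connect_root.
apply: submx_trans (addsmxSr _ _).
apply: submx_trans (sumsmx_sup (fingraph.root (link X) v) _ (submx_refl _)); rewrite ?genmxE //.
by rewrite inE neq roots_root //; apply: link_connect_sym.
Qed.

(** If [y] is unreachable from [x0], the indicator [phi] of the unreachable vertices kills the
    rooted space but not the vector of [y], so the space is not full. *)
Lemma spanning_of_rooted_rank x0 X : (#|V| <= rooted_rank x0 X)%N -> spanning X.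
Proof.
move=> hr; suff hx0 y : connect (link X) x0 y.
  by move=> x y; apply: connect_trans (hx0 y); rewrite link_connect_sym.
apply/negPn/negP => nxy.
pose phi : 'cV[rat]_#|V| := \col_i (~~ connect (link X) x0 (enum_val i))%:R.
have phiE v : vertex_vec v *m phi = (~~ connect (link X) x0 v)%:R%:M.
  by rewrite -rowE; apply/rowP => i; rewrite !mxE enum_rankK ord1.
have : (rooted_space x0 X <= kermx phi)%MS.
  apply: rooted_space_subP => [|e eX]; apply/sub_kermxP.
    by rewrite phiE connect0 raddf0.
  rewrite mulmxBl !phiE.
  suff /(same_connect_r (@link_connect_sym X)) -> :
    connect (link X) (ends e).1 (ends e).2 by rewrite subrr.
  apply: connect1; apply/exists_inP; exists e => //.
  by rewrite /joins -surjective_pairing eqxx.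
have full : row_full (rooted_space x0 X) by rewrite /row_full eqn_leq rank_leq_col.
move=> hk; have := submx_trans (submx_full (vertex_vec y) full) hk.
move/sub_kermxP; rewrite phiE nxy => /matrixP/(_ 0 0); rewrite !mxE /=.
by move/eqP; rewrite oner_eq0.
Qed.

End Multigraph.

(** * Packing connected edge sets and reserved stars *)

Section Packing.

Variable G : mgraph.
Notation V := (vertex G).
Notation E := (edge G).
Implicit Types (X Y : {set E}) (S : {set V}) (e : E) (v x y : V).

Definition cut S : {set E} := [set e | ((ends e).1 \in S) != ((ends e).2 \in S)].

Lemma edge_connected_cut k S x y :
  edge_connected k G -> x \in S -> y \notin S -> k <= #|cut S|.
Proof.
move=> hG xS yS; rewrite leqNgt; apply/negP => /hG/connected_factor/(_ x y).
have clS : closed (link (~: cut S)) S.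
  move=> u v /exists_inP[e]; rewrite !inE negbK => /eqP he.
  by case/orP => /eqP eE; rewrite eE /= in he.
by move/(closed_connect clS); rewrite xS (negPf yS).
Qed.

Lemma sum_incidence S e :
  \sum_(v in S) incidence e v = ((ends e).1 \in S) + ((ends e).2 \in S).
Proof.
have h x : \sum_(v in S) (x == v) = (x \in S).
  rewrite -big_mkcondr /= sum1dep_card; case: (boolP (x \in S)) => xS.
    rewrite (_ : [set _ | _] = [set x]) ?cards1 //.
    by apply/setP => v; rewrite !inE eq_sym; case: eqP => [->|]; rewrite ?xS ?andbF.
  apply/eqP; rewrite cards_eq0; apply/eqP/setP => v; rewrite !inE.
  by apply/negbTE; apply: contraNN xS => /andP[vS /eqP->].
by rewrite big_split /= !h.
Qed.

Lemma sum_deg_in S X :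
  \sum_(v in S) deg_in X v = \sum_(e in X) (((ends e).1 \in S) + ((ends e).2 \in S)).
Proof. by rewrite exchange_big /=; apply: eq_bigr => e _; rewrite sum_incidence. Qed.

Lemma handshake X : \sum_v deg_in X v = 2 * #|X|.
Proof.
rewrite (eq_bigl (mem [set: V])) => [|v]; last by rewrite !inE.
rewrite sum_deg_in; under eq_bigr => e _ do rewrite !inE.
by rewrite sum_nat_const mulnC.
Qed.

Lemma cut_deg_in S X : cut S \subset X -> #|cut S| <= \sum_(v in S) deg_in X v.
Proof.
move=> sX; rewrite sum_deg_in -sum1_card.
apply: leq_trans (_ : \sum_(e in cut S) (((ends e).1 \in S) + ((ends e).2 \in S)) <= _).
  by apply: leq_sum => e; rewrite inE; case: (_ \in S); case: (_ \in S).
by rewrite [leqRHS](big_setID (cut S)) /= (setIidPr sX) leq_addr.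
Qed.

Lemma deg_inT v : deg_in setT v = degree v.
Proof. by apply: eq_bigl => e; rewrite inE. Qed.

Lemma deg_inID X Y v : deg_in X v = deg_in (X :&: Y) v + deg_in (X :\: Y) v.
Proof. exact: big_setID. Qed.

Lemma deg_inC X v : deg_in X v + deg_in (~: X) v = degree v.
Proof. by rewrite -deg_inT (deg_inID setT X) setTI setTD. Qed.

Lemma deg_inS X Y v : X \subset Y -> deg_in X v <= deg_in Y v.
Proof. by move=> /setIidPr sXY; rewrite (deg_inID Y X) sXY leq_addr. Qed.

(** The factor 2 pays for loops, which are one element of the star but count twice in the degree. *)
Lemma deg_in_star X v : deg_in X v <= 2 * #|X :&: star v|.
Proof.
rewrite mulnC -sum_nat_const.
rewrite /deg_in big_mkcond [leqRHS]big_mkcond; apply: leq_sum => e _.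
by rewrite !inE /incidence; case: (e \in X); case: (_ == v); case: (_ == v).
Qed.


(** Twice the inequality is proved by summing degrees outside [X], which total [2 * #|~: X|]. They
    must pay [2 * g v] for the shortfall of each star and [2 * k] for each component avoiding [x0];
    the set [R] holds the roots of these components. *)
Lemma tree_star_rank_bound k x0 X : edge_connected (2 * k) G ->
  k * #|V| + \sum_(v : V) ((degree v)./2 - k)
    <= k * rooted_rank x0 X
       + \sum_(v : V) minn ((degree v)./2 - k) #|X :&: star v| + #|~: X|.
Proof.
move=> hG; pose f (v : V) := (degree v)./2 - k.
pose h v := minn (f v) #|X :&: star v|.
suff: k * #|V| + \sum_v f v <= k * rooted_rank x0 X + \sum_v h v + #|~: X| by [].
pose y v := deg_in (~: X) v.
pose g v := f v - h v.
set rt := fingraph.root (link X).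
set R := [set v | roots (link X) v && (v != rt x0)].
(* If [g v] is positive, then [g v + k + #|X :&: star v|] is exactly half the degree, rounded
   down. *)
have hg v : 2 * g v + 2 * k * (0 < g v) <= y v.
  have := deg_inC X v; have := deg_in_star X v; rewrite /y /g /h /f.
  by case: (ltnP 0 (_ - _)) => /=; lia.
have rtC v w : (rt v == w) -> w \in R -> ~~ connect (link X) v x0.
  move=> /eqP <-; rewrite inE => /andP[_]; apply: contraNN => c.
  by apply/eqP/fingraph.rootP => //; apply: link_connect_sym.
have hR w : \sum_(v | rt v == w) 2 * g v + 2 * k * (w \in R)
              <= \sum_(v | rt v == w) y v.
  case: (boolP (w \in R)) => wR; last first.
    by rewrite muln0 addn0; apply: leq_sum => v _; apply: leq_trans (hg v); apply: leq_addr.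
  case: (boolP [exists v, (rt v == w) && (0 < g v)]) => [/existsP[v /andP[vw gv]]|].
    rewrite (bigD1 v) //= [leqRHS](bigD1 v) //= addnAC; apply: leq_add.
      by have := hg v; rewrite gv.
    by apply: leq_sum => u _; apply: leq_trans (hg u); apply: leq_addr.
  rewrite negb_exists => /forallP g0.
  rewrite big1 => [|v vw]; last by have := g0 v; rewrite vw /= -eqn0Ngt => /eqP->.
  (* No star is deficient in this component [S]. Its whole cut lies outside [X], so
     edge-connectivity supplies the [2 * k]. *)
  rewrite add0n muln1; set S := [set v | rt v == w].
  have rtw : rt w = w by move: wR; rewrite inE => /andP[/eqP].
  have wS : w \in S by rewrite inE rtw.
  have x0S : x0 \notin S.
    by rewrite inE; apply/negP => x0w; have := rtC _ _ x0w wR; rewrite connect0.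
  apply: leq_trans (edge_connected_cut hG wS x0S) _.
  rewrite (eq_bigl (mem S)) => [|v]; last by rewrite !inE.
  apply: cut_deg_in; apply/subsetP => e; rewrite !inE; apply: contraNN => eX.
  suff /(fingraph.rootP (@link_connect_sym _ X)) E : connect (link X) (ends e).1 (ends e).2.
    by rewrite /rt E.
  apply: connect1; apply/exists_inP; exists e => //.
  by rewrite /joins -surjective_pairing eqxx.
have : \sum_v 2 * g v + \sum_w 2 * k * (w \in R) <= \sum_v y v.
  rewrite (partition_big rt xpredT) //= [leqRHS](partition_big rt xpredT) //=.
  by rewrite -big_split; apply: leq_sum => w _; apply: hR.
rewrite -!big_distrr /= handshake -big_mkcond /= sum1_card.
have := rooted_rank_components x0 X; rewrite -/rt -/R.
have -> : \sum_v f v = \sum_v g v + \sum_v h v.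
  by rewrite -big_split; apply: eq_bigr => v _ /=; rewrite /g subnK ?geq_minl.
by move: #|V| => n h1; have := leq_mul (leqnn k) h1; rewrite mulnDr; lia.
Qed.

Theorem tree_star_packing (K : finType) x0 : edge_connected (2 * #|K|) G ->
  exists I : K + V -> {set E},
    [/\ forall i j, i != j -> [disjoint I i & I j],
        forall i, spanning (I (inl i)),
        forall v, I (inr v) \subset star v
      & forall v, (degree v)./2 - #|K| <= #|I (inr v)|].
Proof.
move=> hG; pose f (v : V) := (degree v)./2 - #|K|.
pose r (j : K + V) (X : {set E}) :=
  if j is inr v then minn (f v) #|X :&: star v| else rooted_rank x0 X.
pose cap (j : K + V) := if j is inr v then f v else #|V|.
have r_cap j X : r j X <= cap j.
  by case: j => [i|v] /=; [apply: rank_leq_row | apply: geq_minl].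
case: (@submodular_packing _ _ r _ _ (\sum_j cap j)).
- case=> [i|v] X Y sXY /=; first exact: rooted_rankS.
  by have := subset_leq_card (setSI (star v) sXY); lia.
- case=> [i|v] X Y /=; first exact: rooted_rank_submod.
  have := cardsUI (X :&: star v) (Y :&: star v).
  rewrite -setIUl -setIIl.
  have := subset_leq_card (setSI (star v) (subsetUl X Y)).
  have := subset_leq_card (setSI (star v) (subsetUr X Y)).
  have := subset_leq_card (setSI (star v) (subsetIl X Y)).
  have := subset_leq_card (setSI (star v) (subsetIr X Y)).
  by lia.
- move=> X; rewrite !big_sumType /= !sum_nat_const.
  exact: tree_star_rank_bound.
move=> I [disI hI].
(* The total reaches the sum of the caps and no term exceeds its own cap, so every term attains
   it. *)
have r_full j : cap j <= r j (I j).
  move: hI; rewrite (bigD1 j) //= [leqRHS](bigD1 j) //= => hI.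
  rewrite -(leq_add2r (\sum_(i | i != j) cap i)); apply: leq_trans hI _.
  by rewrite leq_add2l; apply: leq_sum => i _; apply: r_cap.
exists (fun j => if j is inr v then I (inr v) :&: star v else I j); split.
- move=> i j /disI; rewrite -!setI_eq0 => /eqP disij.
  case: i j disij => [i|v] [j|w] disij; rewrite -subset0 -disij ?subxx //;
    by rewrite ?setIS ?setSI ?setISS ?subsetIl.
- by move=> i; apply: (spanning_of_rooted_rank (r_full (inl i))).
- by move=> v; apply: subsetIr.
by move=> v; have := r_full (inr v); rewrite /= leq_min => /andP[].
Qed.

End Packing.

(** * Counting forbidden values above a threshold *)

Lemma count_leq_lt (a b : nat) (s : seq nat) :
  a \in s -> a < b -> count (leq b) s < count (leq a) s.
Proof.
move=> as_ ltab; elim: s as_ => //= x s IHs; rewrite inE => /orP[/eqP <-|/IHs].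
  rewrite leqnn (leqNgt b) ltab add0n add1n ltnS.
  by apply: sub_count => y; apply/leq_trans/ltnW.
have : (b <= x) <= (a <= x) by case: (leqP b x) => // bx; rewrite (leq_trans (ltnW ltab)).
lia.
Qed.

(** The counted values and the elements of [L] form disjoint subsets of the interval from [lo] to
    [hi]. *)
Lemma count_notin_fset (L : {fset nat}) (lo hi a b : nat) :
    (forall k : nat, k \in L -> lo <= k <= hi) -> lo <= a -> b <= hi ->
  count (leq a) [seq i <- iota 0 b.+1 | i \notin L] + #|` L| <= hi.+1 - lo.
Proof.
move=> hL loa bhi; rewrite -size_filter -size_cat -(size_iota lo (hi.+1 - lo)).
apply: uniq_leq_size.
  rewrite cat_uniq !filter_uniq ?iota_uniq ?fset_uniq // andbT andTb.
  by apply/hasPn => k kL; rewrite !mem_filter kL andbF.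
move=> k; rewrite mem_cat !mem_filter !mem_iota => /orP[/and3P[ak _]|/hL]; lia.
Qed.

(** * Greedy degree correction, and spanning trees in factors *)

Section Factors.

Variable G : mgraph.
Notation V := (vertex G).
Notation E := (edge G).
Implicit Types (X Y H R : {set E}) (e : E) (v x y : V).

Lemma deg_in_factor X v : @degree (factor X) v = deg_in X v.
Proof. by rewrite /deg_in big_sub. Qed.

(* Frank, Lau and Szabo: while some vertex t has a forbidden degree, add one of
   its reserved edges. This uses up one reserved edge at t, but the degree of t
   leaves at least one forbidden value behind for good. *)
Lemma avoid_forbidden_degrees (B : V -> {set E}) (bad : V -> seq nat) H R :
    (forall v, B v \subset star v) ->
    (forall u v, u != v -> [disjoint B u & B v]) ->
    [disjoint H & R] ->
    (forall v, count (leq (deg_in H v)) (bad v) <= #|B v :&: R|) ->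
  exists H', [/\ H \subset H', H' \subset H :|: R
               & forall v, deg_in H' v \notin bad v].
Proof.
move=> Bstar disB; have [n] := ubnP #|R|.
elim: n H R => // n IHn H R leRn disHR hB.
case: (boolP [exists v, deg_in H v \in bad v]) => [/existsP[t tbad]|]; last first.
  rewrite negb_exists => /forallP good.
  by exists H; split; rewrite ?subsetUl.
have : 0 < #|B t :&: R|.
  by apply: leq_trans (hB t); rewrite -has_count; apply/hasP; exists (deg_in H t).
case/card_gt0P => e; rewrite inE => /andP[eB eR].
have eH : e \notin H by rewrite (disjointFl disHR).
have degU v : deg_in (e |: H) v = incidence e v + deg_in H v by apply: big_setU1.
have [|||H' [sHH' sH'R good]] := IHn (e |: H) (R :\ e).
- by rewrite (cardsD1 e) eR in leRn.
- rewrite -setI_eq0; apply/eqP/setP => x; rewrite !inE.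
  case: (eqVneq x e) => //= _; apply/negbTE/negP => /andP[xH xR].
  by rewrite (disjointFr disHR xH) in xR.
- move=> v; rewrite degU; case: (eqVneq v t) => [->|vt].
    (* The degree of [t] strictly increases (by 2 for a loop), so its old forbidden value drops out
       of the count and pays for [e]. *)
    have : 0 < incidence e t by move/subsetP: (Bstar t) => /(_ e eB); rewrite inE.
    move=> inc; have lt := @count_leq_lt _ (incidence e t + deg_in H t) _ tbad.
    rewrite -ltnS; apply: leq_trans (lt _) _; first by rewrite -[ltnLHS]add0n ltn_add2r.
    apply: leq_trans (hB t) _.
    by rewrite (cardsD1 e) inE eB eR setIDA.
  (* At another vertex the degree can only grow, which does not raise the count, and [e] is not
     among its reserved edges. *)
  apply: leq_trans (_ : count (leq (deg_in H v)) (bad v) <= _).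
    by apply: sub_count => k; apply/leq_trans/leq_addl.
  apply: leq_trans (hB v) _; apply: subset_leq_card; apply/subsetP => x.
  rewrite !inE => /andP[xB ->]; rewrite xB andbT /=.
  by apply: contraTneq xB => ->; rewrite (disjointFl (disB _ _ vt)).
exists H'; split=> //; first exact: subset_trans (subsetUr _ _) sHH'.
apply: subset_trans sH'R _; apply/subsetP => x; rewrite !inE.
by case: (eqVneq x e) => [->|]; rewrite ?eR ?orbT.
Qed.

Lemma deg_in_spanning X x v : spanning X -> x != v -> 0 < deg_in X v.
Proof.
move=> /(_ v x) /connectP[[|y p] /= pth last] xv; first by rewrite last eqxx in xv.
case/andP: pth => /exists_inP[e eX je] _.
rewrite /deg_in (bigD1 e) //=; apply: leq_trans (leq_addr _ _).
by rewrite /incidence; case/orP: je => /eqP -> /=; rewrite eqxx ?addnS.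
Qed.

Lemma deg_in_bigcup (I : finType) (C : I -> {set E}) v :
  (forall i j, i != j -> [disjoint C i & C j]) ->
  deg_in (\bigcup_i C i) v = \sum_i deg_in (C i) v.
Proof. by move=> disC; apply: partition_disjoint_bigcup. Qed.

Lemma deg_in_spanning_bigcup (I : finType) (C : I -> {set E}) x v :
    (forall i j, i != j -> [disjoint C i & C j]) ->
    (forall i, spanning (C i)) -> x != v ->
  #|I| <= deg_in (\bigcup_i C i) v.
Proof.
move=> disC spC xv; rewrite deg_in_bigcup // -sum1_card.
by apply: leq_sum => i _; apply: deg_in_spanning xv.
Qed.

(** Such a path never traverses the edge of its last entry: it uses only [e] and the edges of [s],
    all distinct from [d]. *)
Lemma cycle_tail_connect X (d : edge (factor X)) (w : V)
    (s : seq (V * edge (factor X))) v (e : edge (factor X)) :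
    path (fun p q => @joins (factor X) p.2 p.1 q.1) (v, e) (rcons s (w, d)) ->
    d != e -> d \notin unzip2 s ->
  connect (link (X :\ val d)) v w.
Proof.
have step (a b : V) (f : edge (factor X)) : @joins (factor X) f a b -> d != f ->
    connect (link (X :\ val d)) a b.
  move=> jf df; apply: connect1; apply/exists_inP; exists (val f) => //.
  by rewrite !inE (valP f) andbT (inj_eq val_inj) eq_sym.
elim: s v e => [|[u f] s IHs] v e /=; first by rewrite andbT => /step h /h.
case/andP => /step h pth /h vu; rewrite inE negb_or => /andP[df ds].
exact: connect_trans vu (IHs _ _ pth df ds).
Qed.

Lemma spanning_cycle_remove X (d : edge (factor X)) (w : V) (s : seq (V * edge (factor X))) :
  spanning X -> @is_cycle (factor X) ((w, d) :: s) -> spanning (X :\ val d).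
Proof.
move=> spX [_ _ /= /andP[ds _] cyc].
(* Here [u] is the vertex after [w] on the cycle; it is [w] itself when [d] is a loop. *)
have [u [jd cu]] : exists u, joins (val d) w u /\ connect (link (X :\ val d)) u w.
  case: s ds cyc => [|[u f] s] /=; first by rewrite andbT => _ jd; exists w.
  rewrite inE negb_or => /andP[df ds] /andP[jd pth].
  by exists u; split => //; apply: cycle_tail_connect pth df ds.
have cuC := cu; rewrite link_connect_sym in cuC.
suff sub : subrel (link X) (connect (link (X :\ val d))).
  by move=> x y; apply: connect_sub sub _ _ (spX x y).
move=> x y /exists_inP[e eX je]; case: (eqVneq e (val d)) => [eE|ed]; last first.
  by apply: connect1; apply/exists_inP; exists e; rewrite // !inE ed.
by move: je jd; rewrite eE /joins => /orP[] /eqP -> /orP[] /eqP[-> ->] //.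
Qed.

(** An inclusion-minimal spanning subset has no cycle, since an edge of a cycle could be removed. *)
Lemma spanning_tree X : spanning X -> exists2 T : {set E}, T \subset X & is_tree (factor T).
Proof.
pose P X := [forall x, forall y, connect (link X) x y].
have PP Y : reflect (spanning Y) (P Y) by apply: (iffP forallP) => h x; apply/forallP.
move=> /PP/minset_exists[T /minsetP[/PP spT minT] sTX]; exists T => //.
split; first exact/connected_factor.
case=> [|[w d] s] cyc; first by case: cyc.
have /PP/minT := spanning_cycle_remove spT cyc.
rewrite subsetDl => /(_ isT)/setP/(_ (val d)).
by rewrite !inE eqxx (valP d).
Qed.

End Factors.

(** * Assembling the factor from a packing *)

Lemma tree_connected_factor (G : mgraph) m (F : {set edge G})
    (C : 'I_m -> {set edge G}) :
    (forall i j, i != j -> [disjoint C i & C j]) ->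
    (forall i, C i \subset F) -> (forall i, spanning (C i)) ->
  tree_connected m (factor F).
Proof.
move=> disC sCF spC.
(* The trees must be edge sets of [factor F], so each [C i] is pulled back to its edge type before
   being cut down to a tree. *)
pose X i : {set edge (factor F)} := [set e | val e \in C i].
have spX i : spanning (X i).
  move=> x y; have := spC i x y; rewrite (@eq_connect _ _ (link (X i))) // => a b.
  apply/exists_inP/exists_inP => [[e eC je]|[e]]; last by rewrite inE; exists (val e).
  by exists (Sub e (subsetP (sCF i) e eC)); rewrite ?inE.
have [T sTX treeT] := fin_all_exists2 (fun i => spanning_tree (spX i)).
exists T; split=> // i j neq_ij.
apply: disjointWl (sTX i) _; apply: disjointWr (sTX j) _.
rewrite -setI_eq0; apply/eqP/setP => e; rewrite !inE.
by apply/negbTE/negP => /andP[ei]; rewrite (disjointFr (disC _ _ neq_ij) ei).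
Qed.

(** [H0] is forced into the factor and [H1] out of it, so degrees stay at most
    [degree v - deg_in H1 v]. Only values up to that bound need to be listed as forbidden. *)
Lemma list_factor_of_packing (m m0 : nat) (G : mgraph)
    (L : vertex G -> {fset nat}) (I : 'I_m + 'I_m0 + vertex G -> {set edge G})
    (H0 := \bigcup_i I (inl (inl i))) (H1 := \bigcup_i I (inl (inr i))) :
    (forall i j, i != j -> [disjoint I i & I j]) ->
    (forall i, spanning (I (inl i))) -> (forall v, I (inr v) \subset star v) ->
    (forall v, count (leq (deg_in H0 v))
       [seq k <- iota 0 (degree v - deg_in H1 v).+1 | k \notin L v]
       <= #|I (inr v)|) ->
  exists F : {set edge G},
    [/\ tree_connected m (factor F),
        forall v : vertex G, @degree (factor F) v \in L v
      & tree_connected m0 (factor (~: F))].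
Proof.
move=> disI spI Istar hcount.
have disH x : x \in H0 -> x \in H1 -> False.
  case/bigcupP => i _ xi /bigcupP[j _ xj].
  by have := disjointFr (disI (inl (inl i)) (inl (inr j)) isT) xi; rewrite xj.
have [||| F [sH0F sFH good]] := @avoid_forbidden_degrees G (fun v => I (inr v))
  (fun v => [seq k <- iota 0 (degree v - deg_in H1 v).+1 | k \notin L v])
  H0 (~: (H0 :|: H1)) Istar.
- by move=> u v uv; apply: disI.
- by rewrite -setI_eq0; apply/eqP/setP => x; rewrite !inE; case: (x \in H0).
- move=> v; rewrite (setIidPl _) //; apply/subsetP => x xv; rewrite !inE.
  apply/negP => /orP[] /bigcupP[i _ xi].
    by have := disjointFr (disI (inr v) (inl (inl i)) isT) xv; rewrite xi.
  by have := disjointFr (disI (inr v) (inl (inr i)) isT) xv; rewrite xi.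
have sH1F : H1 \subset ~: F.
  apply/subsetP => x xH1; rewrite inE; apply/negP => /(subsetP sFH).
  by rewrite !inE xH1 orbT orbF => /disH/(_ xH1).
exists F; split.
- apply: (@tree_connected_factor _ _ _ (fun i => I (inl (inl i)))) => // [i j ij|i].
    exact: disI.
  by apply: subset_trans sH0F; apply: bigcup_sup.
- move=> v; rewrite deg_in_factor; have := good v.
  rewrite mem_filter mem_iota negb_and negbK /= add0n ltnS => /orP[//|].
  by have := deg_inC F v; have := deg_inS v sH1F; lia.
apply: (@tree_connected_factor _ _ _ (fun i => I (inl (inr i)))) => // [i j ij|i].
  exact: disI.
by apply: subset_trans sH1F; apply: bigcup_sup.
Qed.

Local Open Scope fset_scope.
Local Open Scope nat_scope.

Theorem theorem3p4 (m m0 : nat) (G : mgraph) (L : vertex G -> {fset nat})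
  (hG : edge_connected (2 * m + 2 * m0) G)
  (hLsub : forall (v : vertex G) (k : nat),
     k \in L v -> m <= k /\ k + m0 <= degree v)
  (hLcard : forall v : vertex G, uphalf (degree v) + 1 <= #|` L v|) :
  exists F : {set edge G},
    [/\ tree_connected m (factor F),
        forall v : vertex G, @degree (factor F) v \in L v
      & tree_connected m0 (factor (~: F))].
Proof.
have uphalfE v : degree v - uphalf (degree v) = (@degree G v)./2.
  by rewrite -[X in X - _]odd_double_half uphalf_half; lia.
(* With at most one vertex, empty sets are spanning, so [H0] need not have degree [m]. All connected
   sets are taken empty and every edge is reserved; the star has at least half the degree many
   edges, enough for the forbidden values in the range from 0. *)
case: (leqP #|vertex G| 1) => [/fintype_le1P V1|/card_gt1P[x0 [x1 [_ _ neq_x]]]].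
  have eqV (x y : vertex G) : x = y by apply: V1.
  pose I (j : 'I_m + 'I_m0 + vertex G) := if j is inr v then star v else set0.
  apply: (@list_factor_of_packing m m0 G L I) => [[i|v] [j|w]|i x y|v|v] //=.
  - by move=> _; rewrite -setI_eq0 set0I.
  - by move=> _; rewrite -setI_eq0 set0I.
  - by move=> _; rewrite -setI_eq0 setI0.
  - by rewrite (eqV v w) eqxx.
  - by rewrite (eqV x y) connect0.
  have hL k : k \in L v -> 0 <= k <= degree v by move/hLsub; lia.
  rewrite -(leq_add2r #|` L v|).
  apply: leq_trans (count_notin_fset hL (leq0n _) (leq_subr _ _)) _.
  have := hLcard v; have := uphalfE v; have := deg_in_star setT v.
  by rewrite deg_inT setTI; lia.
have hGK : edge_connected (2 * #|{: 'I_m + 'I_m0}|) G.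
  by rewrite card_sum !card_ord mulnDr.
have [I [disI spI Istar cardI]] := tree_star_packing x0 hGK.
apply: (list_factor_of_packing disI spI Istar) => v.
(* A second vertex forces each spanning set to have an edge at [v], whence the bounds [m] and [m0]
   below. *)
have [x xv] : exists x, x != v.
  by case: (eqVneq x0 v) => [<-|]; [exists x1; rewrite eq_sym | exists x0].
have h0 : m <= deg_in (\bigcup_i I (inl (inl i))) v.
  rewrite -[leqLHS]card_ord; apply: deg_in_spanning_bigcup xv => // i j ij.
  exact: disI.
have h1 : m0 <= deg_in (\bigcup_i I (inl (inr i))) v.
  rewrite -[leqLHS]card_ord; apply: deg_in_spanning_bigcup xv => // i j ij.
  exact: disI.
have hL k : k \in L v -> m <= k <= degree v - m0 by move/hLsub; lia.
(* The interval has at most [degree v - m0 - m + 1] values and [L v] takes at least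
   [uphalf (degree v) + 1] of them, leaving at most [(degree v)./2 - (m + m0)] forbidden ones. *)
rewrite -(leq_add2r #|` L v|).
apply: leq_trans (count_notin_fset hL h0 (leq_sub2l _ h1)) _.
have := hLcard v; have := uphalfE v; have := cardI v.
by rewrite card_sum !card_ord; move: #|I _| => n; lia.
Qed.
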